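(* Let $\mathcal{H}$ be a real or complex Hilbert space. For any proper nontrivial subspaces $\mathcal{F}$ and $\mathcal{G}$ of $\mathcal{H}$ the following equalities hold: 1. $\Theta(\mathcal{F},\mathcal{G})\setminus(\{0\}\cup\{\pi/2\})=\{\pi/2-\Theta(\mathcal{F},\mathcal{G}^\perp)\}\setminus(\{0\}\cup\{\pi/2\})$; 2. $\Theta(\mathcal{F},\mathcal{G})\setminus\{0\}=\Theta(\mathcal{F}^\perp,\mathcal{G}^\perp)\setminus\{0\}$; 3. $\Theta(\mathcal{F},\mathcal{G}^\perp)\setminus\{0\}=\Theta(\mathcal{F}^\perp,\mathcal{G})\setminus\{0\}$. Moreover, with $\mathfrak{M}_{00}=\mathcal{F}\cap\mathcal{G}$, $\mathfrak{M}_{01}=\mathcal{F}\cap\mathcal{G}^\perp$, $\mathfrak{M}_{10}=\mathcal{F}^\perp\cap\mathcal{G}$, $\mathfrak{M}_{11}=\mathcal{F}^\perp\cap\mathcal{G}^\perp$, the multiplicities of the angles $\theta=0$ and $\theta=\pi/2$ are as follows (multiplicity of $0$; multiplicity of $\pi/2$): - in $\Theta(\mathcal{F},\mathcal{G})$: $\dim\mathfrak{M}_{00}$; $\min\{\dim\mathfrak{M}_{01},\dim\mathfrak{M}_{10}\}$; - in $\Theta(\mathcal{F},\mathcal{G}^\perp)$: $\dim\mathfrak{M}_{01}$; $\min\{\dim\mathfrak{M}_{00},\dim\mathfrak{M}_{11}\}$; - in $\Theta(\mathcal{F}^\perp,\mathcal{G})$: $\dim\mathfrak{M}_{10}$; $\min\{\dim\mathfrak{M}_{00},\dim\mathfrak{M}_{11}\}$;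 - in $\Theta(\mathcal{F}^\perp,\mathcal{G}^\perp)$: $\dim\mathfrak{M}_{11}$; $\min\{\dim\mathfrak{M}_{01},\dim\mathfrak{M}_{10}\}$. Finally, the multiplicities of the point angles $\theta$ in $\Theta(\mathcal{F},\mathcal{G})$ and $\Theta(\mathcal{F}^\perp,\mathcal{G}^\perp)$ satisfying $0<\theta<\pi/2$ are the same, and equal to the multiplicities of the point angles $0<\pi/2-\theta<\pi/2$ in $\Theta(\mathcal{F},\mathcal{G}^\perp)$ and $\Theta(\mathcal{F}^\perp,\mathcal{G})$.
   Context: A subspace means a closed linear manifold; nontrivial means different from $\{0\}$, proper means different from $\mathcal{H}$. $P_{\mathcal{F}}$ denotes the orthogonal projector onto $\mathcal{F}$; $(P_{\mathcal{F}}P_{\mathcal{G}})|_{\mathcal{F}}$ is the restriction to $\mathcal{F}$, regarded as an operator $\mathcal{F}\to\mathcal{F}$. $\Sigma(T)$ and $\Sigma_p(T)$ denote the spectrum and point spectrum (set of eigenvalues) of $T$. The set of angles from $\mathcal{F}$ to $\mathcal{G}$ is $$\hat{\Theta}(\mathcal{F},\mathcal{G})=\{\theta:\theta=\arccos(\sigma),\ \sigma\ge 0,\ \sigma^2\in\Sigma((P_{\mathcal{F}}P_{\mathcal{G}})|_{\mathcal{F}})\}\subseteq[0,\pi/2],$$ and the set of angles between $\mathcal{F}$ and $\mathcal{G}$ is $\Theta(\mathcal{F},\mathcal{G})=\hat{\Theta}(\mathcal{F},\mathcal{G})\cap\hat{\Theta}(\mathcal{G},\mathcal{F})$. The point angles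 are $\hat{\Theta}_p(\mathcal{F},\mathcal{G})=\{\theta\in\hat{\Theta}(\mathcal{F},\mathcal{G}):\cos^2(\theta)\in\Sigma_p((P_{\mathcal{F}}P_{\mathcal{G}})|_{\mathcal{F}})\}$ and $\Theta_p(\mathcal{F},\mathcal{G})=\hat{\Theta}_p(\mathcal{F},\mathcal{G})\cap\hat{\Theta}_p(\mathcal{G},\mathcal{F})$. The multiplicity of $\theta\in\hat{\Theta}_p(\mathcal{F},\mathcal{G})$ is the multiplicity (dimension of the eigenspace) of the eigenvalue $\cos^2(\theta)$ of $(P_{\mathcal{F}}P_{\mathcal{G}})|_{\mathcal{F}}$; the multiplicity of $\theta\in\Theta_p(\mathcal{F},\mathcal{G})$ is the minimum of its multiplicities in $\hat{\Theta}_p(\mathcal{F},\mathcal{G})$ and $\hat{\Theta}_p(\mathcal{G},\mathcal{F})$. Multiplicity zero means that the value is not a point angle. For a set $S$ of reals, $\pi/2-S=\{\pi/2-s:s\in S\}$. Dimensions and multiplicities are either finite numbers or $\infty$; only finite versus infinite is distinguished, and $\min\{q,\infty\}=q$ for finite $q$. *)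

(* Defs.v *)
From HB Require Import structures.
From mathcomp Require Import all_boot all_order all_algebra.
From mathcomp Require Import all_classical all_reals all_analysis.
From mathcomp Require Import complex.

Set Implicit Arguments.
Unset Strict Implicit.
Unset Printing Implicit Defensive.

Import Order.TTheory GRing.Theory Num.Theory.
Import numFieldNormedType.Exports.

Local Open Scope classical_set_scope.
Local Open Scope ring_scope.

Variant scalars := RealScalars | ComplexScalars.

Definition scalar_field (R : realType) (k : scalars) : numFieldType :=
  match k with RealScalars => R | ComplexScalars => R[i] end.

Definition scalar_conj (R : realType) (k : scalars) :
    scalar_field R k -> scalar_field R k :=
  match k with RealScalars => idfun | ComplexScalars => @conjc R end.

Definition of_real (R : realType) (k : scalars) : R -> scalar_field R k :=
  match k with RealScalars => idfun | ComplexScalars => real_complex R end.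
Arguments of_real {R} k _.

(* The inner product, an instance of MathComp's positive definite hermitian
   forms, is linear in its first argument. *)
Definition inner_product_space_norm (R : realType) (k : scalars)
    (H : normedModType (scalar_field R k)) (dot : {dot H for @scalar_conj R k}) :=
  forall x : H, `|x| ^+ 2 = dot x x.

Section Operators.
Variables (K : numFieldType) (H : normedModType K).
Implicit Types (F : set H) (T : H -> H) (lambda : K).

Definition closed_subspace F := submod_closed [in F] /\ closed F.

(* In the definitions below T stands for an operator F -> F: only its values
   on F, which are to lie in F, are used. *)

(* S restricted to F is a bounded linear operator on F inverse to T. *)
Definition bounded_inverse F T (S : H -> H) :=
  [/\ set_fun F F S,
      forall (a : K) (x y : H), F x -> F y -> S (a *: x + y) = a *: S x + S y,
      exists M : K, forall x, F x -> `|S x| <= M * `|x|,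
      forall x, F x -> S (T x) = x &
      forall x, F x -> T (S x) = x].

Definition spectrum F T : set K :=
  [set lambda | ~ exists S, bounded_inverse F (fun x => T x - lambda *: x) S].

Definition eigenspace_on F T lambda : set H :=
  [set x | F x /\ T x = lambda *: x].

Definition point_spectrum F T : set K :=
  [set lambda | exists2 x, eigenspace_on F T lambda x & x != 0].

Definition is_basis (V : set H) (n : nat) (e : 'I_n -> H) :=
  (forall c : 'I_n -> K, \sum_i c i *: e i = 0 -> forall i, c i = 0) /\
  V = [set x | exists c : 'I_n -> K, x = \sum_i c i *: e i].

End Operators.

(* n if V has a basis of n vectors, and +oo if V has no finite basis. *)
Definition dimension (R : realType) (K : numFieldType) (H : normedModType K)
    (V : set H) : \bar R :=
  xget +oo%E
    [set d | exists n (e : 'I_n -> H), is_basis V e /\ d = (n%:R)%:E].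
Arguments dimension R {K H} V.

Section Angles.
Variables (R : realType) (k : scalars).
Local Notation K := (scalar_field R k).
Variables (H : normedModType K) (dot : {dot H for @scalar_conj R k}).
Implicit Types (F G : set H) (theta : R).

Definition orthocomp F : set H := [set x | forall y, F y -> dot x y = 0].

(* For a closed subspace F of a Hilbert space there is exactly one such y. *)
Definition orthoproj F (x : H) : H := xget 0 [set y | F y /\ orthocomp F (x - y)].

(* \hat\Theta(F, G) *)
Definition angles_from F G : set R :=
  [set theta | exists sigma : R, [/\ theta = acos sigma, 0 <= sigma &
     spectrum F (orthoproj F \o orthoproj G) (of_real k (sigma ^+ 2))]].

(* \Theta(F, G) *)
Definition angles F G : set R := angles_from F G `&` angles_from G F.

Definition point_angles_from F G : set R :=
  [set theta | angles_from F G theta /\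
     point_spectrum F (orthoproj F \o orthoproj G) (of_real k (cos theta ^+ 2))].

Definition point_angles F G : set R :=
  point_angles_from F G `&` point_angles_from G F.

Definition mult_from F G theta : \bar R :=
  if `[< point_angles_from F G theta >]
  then dimension R
    (eigenspace_on F (orthoproj F \o orthoproj G) (of_real k (cos theta ^+ 2)))
  else 0%E.

(* The multiplicity of theta in \Theta(F, G), 0 when theta is not a point
   angle. *)
Definition mult F G theta : \bar R :=
  if `[< point_angles F G theta >]
  then Order.min (mult_from F G theta) (mult_from G F theta)
  else 0%E.

End Angles.

(* Main.v *)
From HB Require Import structures.
Require Import Defs.
From mathcomp Require Import all_boot all_order all_algebra.
From mathcomp Require Import all_classical all_reals all_analysis.
From mathcomp Require Import complex ring.

(** The cosines of the angles come from spectra of products of orthogonal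
    projectors, and three algebraic facts relate these spectra.  Write
    T(F, G) for the restriction of P_F P_G to F.

    - Complement in the second argument.  Since P_(G^perp) = 1 - P_G and P_F
      is the identity on F, T(F, G^perp) = 1 - T(F, G).  Hence lambda belongs
      to the spectrum of T(F, G) iff 1 - lambda belongs to that of
      T(F, G^perp), with the same eigenspace ([spectrum_orthocompr],
      [eigenspace_orthocompr]).
    - Exchange of the arguments.  With A = P_G : F -> G and B = P_F : G -> F
      one has T(F, G) = B A and T(G, F) = A B, and B A and A B have the same
      spectrum away from 0; for lambda <> 0, A maps the lambda-eigenspace of
      B A bijectively onto that of A B ([spectrum_projprojC],
      [dimension_eigenspaceC]).
    - Both complements.  Complement, exchange and complement again lead from
      lambda for (F, G) through 1 - lambda for (F, G^perp) and (G^perp, F) to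
      lambda for (G^perp, F^perp).  The exchange takes place at 1 - lambda,
      so the only excluded value is lambda = 1, that is, the angle 0
      ([spectrum_orthocomp]).

    As cos^2 (pi/2 - theta) = 1 - cos^2 theta, these facts are the three
    equalities of sets of angles and the equalities of multiplicities for
    0 < theta < pi/2.  At the ends, the eigenvalue 1 of T(F, G) has the
    eigenspace F /\ G, because a contraction that is a product of projectors
    fixes x only if both projectors do, and by the complement rule the
    eigenvalue 0 has the eigenspace F /\ G^perp.

    Completeness of the space enters only through the projection theorem
    ([closed_complemented]); everything else holds for subspaces F such that
    the space is the sum of F and F^perp, a class that is stable under
    orthogonal complements. *)

Set Implicit Arguments.
Unset Strict Implicit.
Unset Printing Implicit Defensive.

Import Order.TTheory GRing.Theory Num.Theory.
Import numFieldNormedType.Exports.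

Local Open Scope classical_set_scope.
Local Open Scope ring_scope.

(** * Spectra and dimensions *)

Section Operators.
Variables (K : numFieldType) (H : normedModType K).
Implicit Types (F G V W : set H) (T S : H -> H) (lambda : K).

Lemma submod_closedE F : submod_closed [in F] <->
  F 0 /\ forall (a : K) x y, F x -> F y -> F (a *: x + y).
Proof.
split=> -[F0 FD]; split.
- by move: F0; rewrite !inE.
- by move=> a x y Fx Fy; have := FD a x y; rewrite !inE; exact.
- by rewrite !inE.
- by move=> a x y; rewrite !inE; exact: FD.
Qed.

Lemma bounded_inverse0 F T S : F 0 -> bounded_inverse F T S -> S 0 = 0.
Proof.
move=> F0 [_ Slin _ _ _]; have := Slin 1 0 0 F0 F0.
by rewrite !scale1r addr0 => /esym/eqP; rewrite -subr_eq0 addrK => /eqP.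
Qed.

Lemma point_spectrum_spectrum F T lambda : F 0 ->
  point_spectrum F T lambda -> spectrum F T lambda.
Proof.
move=> F0 [x [Fx Tx] x0] [S bS]; move: (bS) => [_ _ _ ST _].
by move: (ST x Fx) x0; rewrite Tx subrr (bounded_inverse0 F0 bS) => <-; rewrite eqxx.
Qed.

Lemma bounded_inverse_opp F T S : submod_closed [in F] ->
  bounded_inverse F T S -> bounded_inverse F (fun x => - T x) (fun x => S (- x)).
Proof.
move=> /submod_closedE[F0 FD] bS; have [SF Slin [M SM] ST TS] := bS.
have FN x : F x -> F (- x).
  by move=> Fx; rewrite -[- x]addr0 -scaleN1r; exact: FD.
split.
- by move=> x Fx; exact/SF/FN.
- by move=> a x y Fx Fy; rewrite opprD -scalerN Slin//; exact: FN.
- by exists M => x Fx; rewrite (le_trans (SM _ (FN _ Fx)))// normrN.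
- by move=> x Fx; rewrite opprK ST.
- by move=> x Fx; rewrite TS ?opprK//; exact: FN.
Qed.

Lemma eq_bounded_inverse F T T' S : submod_closed [in F] ->
  (forall x, F x -> T x = T' x) -> bounded_inverse F T S -> bounded_inverse F T' S.
Proof.
move=> sF TT' [SF Slin SM ST TS]; split=> // x Fx; first by rewrite -TT'// ST.
by rewrite -TT' ?TS//; exact: SF.
Qed.

Lemma spectrum_one_minus F T T' lambda : submod_closed [in F] ->
  (forall x, F x -> T' x = x - T x) ->
  spectrum F T lambda <-> spectrum F T' (1 - lambda).
Proof.
move=> sF TT'; have TE x : F x -> T x = x - T' x.
  by move=> Fx; rewrite TT'// subKr.
split=> nS [S bS]; apply: nS; have := bounded_inverse_opp sF bS;
  move=> /(eq_bounded_inverse sF) bS'; eexists; apply: bS' => x Fx.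
  by rewrite TT'// scalerBl scale1r !opprB addrC addrA subrK.
by rewrite TE// scalerBl scale1r !opprB addrCA.
Qed.

(** The constant of a [bounded_inverse] is an arbitrary scalar; composing
    bounds requires a nonnegative one, and the norm of the scalar serves. *)
Lemma ge0_bound F S : F 0 -> (exists M : K, forall x, F x -> `|S x| <= M * `|x|) ->
  exists2 M : K, 0 <= M & forall x, F x -> `|S x| <= M * `|x|.
Proof.
move=> F0 [M SM]; exists `|M| => // x Fx; have := SM x Fx.
have Mx0 : 0 <= M * `|x| by exact: le_trans (SM x Fx).
by rewrite -[M * _]ger0_norm// normrM normr_id.
Qed.

(** If S inverts B A - lambda, then (A S B - 1) / lambda inverts A B - lambda,
    because A (B A - lambda) = (A B - lambda) A. *)
Lemma bounded_inverse_swap F G (A B : {linear H -> H}) (a b : K) lambda :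
  submod_closed [in F] -> submod_closed [in G] ->
  set_fun F G A -> set_fun G F B ->
  (forall x, `|A x| <= a * `|x|) -> (forall x, `|B x| <= b * `|x|) ->
  lambda != 0 ->
  (exists S, bounded_inverse F (fun x => (B \o A) x - lambda *: x) S) ->
  exists S, bounded_inverse G (fun x => (A \o B) x - lambda *: x) S.
Proof.
move=> /submod_closedE[F0 FD] /submod_closedE[G0 GD] AG BF.
move=> /(fun h => @ge0_bound setT A I (ex_intro _ a (fun x _ => h x)))[{}a a0 Aa].
move=> /(fun h => @ge0_bound setT B I (ex_intro _ b (fun x _ => h x)))[{}b b0 Bb].
move=> l0 [S [SF Slin /(ge0_bound F0)[M M0 SM] ST TS]].
exists (fun y => lambda^-1 *: (A (S (B y)) - y)); split.
- move=> y Gy; have GA : G (A (S (B y))) by exact/AG/SF/BF.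
  have Gd : G (A (S (B y)) - y) by rewrite addrC -scaleN1r; exact: GD.
  by rewrite -[_ *: _]addr0; exact: GD.
- move=> c x y Gx Gy; rewrite linearP Slin; [|exact: BF..].
  rewrite linearP scalerA mulrC -scalerA -scalerDr; congr (_ *: _).
  by rewrite scalerBr opprD addrACA.
- exists (`|lambda^-1| * (a * (M * b) + 1)) => y Gy.
  rewrite normrZ -mulrA ler_wpM2l// (le_trans (ler_normB _ _))//.
  rewrite mulrDl mul1r lerD2r (le_trans (Aa _ I))// -mulrA ler_wpM2l//.
  by rewrite (le_trans (SM _ (BF _ Gy)))// -mulrA ler_wpM2l//; exact: Bb.
- move=> y Gy /=; have := ST (B y) (BF _ Gy) => /= E.
  rewrite [B (_ - _)]linearB [B (_ *: _)]linearZ/= E opprB addrCA subrr addr0 scalerA mulVf//.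
  by rewrite scale1r.
- move=> y Gy /=; have := TS (B y) (BF _ Gy) => /=.
  move=> /(congr1 A); rewrite [A (_ - _)]linearB [A (_ *: _)]linearZ/= => E.
  rewrite [B (_ *: _)]linearZ [B (_ - _)]linearB [A (_ *: _)]linearZ/=.
  rewrite [A (_ - _)]linearB -E opprB addrCA subrr addr0 !scalerA mulVf// mulfV//.
  by rewrite !scale1r subKr.
Qed.

Lemma sum_delta (n : nat) (e : 'I_n -> H) i :
  \sum_j (j == i)%:R *: e j = e i.
Proof.
rewrite (bigD1 i)//= eqxx scale1r big1 ?addr0// => j /negbTE ->.
by rewrite scale0r.
Qed.

Lemma is_basis_mem V n (e : 'I_n -> H) i : is_basis V e -> V (e i).
Proof. by move=> [_ ->]; exists (fun j => (j == i)%:R); rewrite sum_delta. Qed.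

Lemma is_basis_image V n (e : 'I_n -> H) (A : {linear H -> H}) :
  (forall x, V x -> A x = 0 -> x = 0) ->
  is_basis V e -> is_basis (A @` V) (A \o e).
Proof.
have AS c : \sum_i c i *: A (e i) = A (\sum_i c i *: e i).
  by rewrite linear_sum; apply: eq_bigr => i _; rewrite linearZ.
move=> Ainj [efree VE]; split.
  move=> c /=; rewrite AS => /Ainj Ae; apply: efree; apply: Ae.
  by rewrite VE; exists c.
rewrite VE; apply/seteqP; split=> [_ [_ [c ->] <-]|_ [c ->]] /=.
  by exists c; rewrite AS.
by rewrite AS; eexists; [exists c; reflexivity|].
Qed.

(** A and B need not be inverse to each other: a basis of either space is
    carried to a basis of the other, so the two sets of dimensions of bases
    coincide, and [dimension] picks the same element from both. *)
Lemma dimension_eq_image (R : realType) V W (A B : {linear H -> H}) :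
  A @` V = W -> (forall x, V x -> A x = 0 -> x = 0) ->
  B @` W = V -> (forall x, W x -> B x = 0 -> x = 0) ->
  dimension R V = dimension R W.
Proof.
move=> AV Ainj BW Binj; rewrite /dimension; congr xget.
apply/seteqP; split=> _ [n [e [be ->]]]; exists n.
  by exists (A \o e); split=> //; rewrite -AV; exact: is_basis_image.
by exists (B \o e); split=> //; rewrite -BW; exact: is_basis_image.
Qed.

Lemma dimension0 (R : realType) : dimension R [set 0 : H] = 0%E.
Proof.
rewrite /dimension; case: xgetP => [_ _ [[|n] [e [be ->]]]|] //.
  have [efree _] := be; have /= e0 := is_basis_mem ord0 be.
  have := efree (fun j => (j == ord0)%:R).
  by rewrite sum_delta => /(_ e0 ord0)/eqP; rewrite eqxx oner_eq0.
move=> /(_ 0%E) []; exists 0%N, (fun=> 0); split=> //; split; first by move=> c _ [].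
apply/seteqP; split=> [x ->|x [c ->]]; last by rewrite big_ord0.
by exists (fun=> 0); rewrite big_ord0.
Qed.

Lemma dimension_ge0 (R : realType) V : (0 <= dimension R V)%E.
Proof.
rewrite /dimension; case: xgetP => [_ _ [n [e [_ ->]]]|_]; last exact: leey.
by rewrite lee_fin ler0n.
Qed.

End Operators.

(** * Real and complex scalars *)

Section Scalars.
Variables (R : realType) (k : scalars).
Local Notation K := (scalar_field R k).

Lemma of_real0 : of_real k 0 = 0 :> K. Proof. by case: k. Qed.

Lemma of_real1 : of_real k 1 = 1 :> K. Proof. by case: k. Qed.

Lemma of_realB (a b : R) : of_real k (a - b) = of_real k a - of_real k b.
Proof. by case: k => //=; rewrite rmorphB. Qed.

Lemma of_real_inj : injective (@of_real R k).
Proof. by case: k => //= a b []. Qed.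

Lemma scalar_conj0 : scalar_conj (0 : K) = 0.
Proof. by case: k => //; exact: conjc0. Qed.

Lemma scalar_conj_div (a b : K) :
  scalar_conj (a / b) = scalar_conj a / scalar_conj b.
Proof. by case: k a b => //= a b; rewrite rmorphM/= conjc_inv. Qed.

Lemma mul_conj_ge0 (a : K) : 0 <= a * scalar_conj a.
Proof.
by case: k a => /= a; [rewrite -expr2 sqr_ge0|exact: mulcJ_ge0].
Qed.

Lemma mul_conj_eq0 (a : K) : a * scalar_conj a = 0 -> a = 0.
Proof.
case: k a => /= a /eqP; first by rewrite mulf_eq0 orbb => /eqP.
by rewrite mulf_eq0 conjc_eq0 orbb => /eqP.
Qed.

(** Nonnegative complex numbers are real, so sets of nonnegative scalars have
    infima also over the complex numbers, where the order is partial. *)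
Lemma ge0_inf_adherent (A : set K) : A !=set0 -> (forall a, A a -> 0 <= a) ->
  exists d, [/\ 0 <= d, forall a, A a -> d <= a &
                forall e, 0 < e -> exists2 a, A a & a < d + e].
Proof.
have real_case (B : set R) : B !=set0 -> (forall a, B a -> 0 <= a) ->
  exists d, [/\ 0 <= d, forall a, B a -> d <= a &
                forall e, 0 < e -> exists2 a, B a & a < d + e].
  move=> B0 Bge0; have hB : has_inf B by split=> //; exists 0.
  exists (inf B); split; first exact: lb_le_inf.
    by move=> a Ba; apply: ge_inf => //; exists 0.
  by move=> e e0; have [a Ba ?] := inf_adherent e0 hB; exists a.
case: k A => //= A [a0 Aa0] Age0.
have ReK (z : R[i]) : 0 <= z -> z = (complex.Re z)%:C%C.
  by rewrite lecE/= => /andP[/eqP + _]; case: z => x y /= ->.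
have [||d [d0 dA dP]] := real_case (@complex.Re R @` A).
- by exists (complex.Re a0), a0.
- by move=> _ [a /Age0 + <-]; rewrite lecE/= => /andP[].
exists (d%:C%C); split.
- by rewrite ler0c.
- by move=> a Aa; rewrite (ReK _ (Age0 _ Aa)) lecR; apply: dA; exists a.
- move=> e e0; have eE := ReK _ (ltW e0).
  have [|_ [a Aa <-] ad] := dP (complex.Re e); first by rewrite -ltcR -eE.
  by exists a => //; rewrite (ReK _ (Age0 _ Aa)) eE -rmorphD/= ltcR.
Qed.

End Scalars.

(** * Orthogonal complements and projectors *)

Section InnerProduct.
Variables (R : realType) (k : scalars).
Local Notation K := (scalar_field R k).
Variables (H : normedModType K) (dot : {dot H for @scalar_conj R k}).
Hypothesis norm_dot : inner_product_space_norm dot.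
Implicit Types (F G : set H) (x y : H).
Local Notation "F ^_|_" := (orthocomp dot F).

Lemma dotDl x y z : dot (x + y) z = dot x z + dot y z.
Proof. exact: linearDl. Qed.

Lemma dotBl x y z : dot (x - y) z = dot x z - dot y z.
Proof. exact: linearBl. Qed.

Lemma dotZl a x y : dot (a *: x) y = a * dot x y.
Proof. exact: linearZl_LR. Qed.

Lemma dotDr x y z : dot x (y + z) = dot x y + dot x z.
Proof. exact: linearDr. Qed.

Lemma dotBr x y z : dot x (y - z) = dot x y - dot x z.
Proof. exact: linearBr. Qed.

Lemma dotZr a x y : dot x (a *: y) = scalar_conj a * dot x y.
Proof. exact: linearZr_LR. Qed.

Lemma dot_conj x y : dot x y = scalar_conj (dot y x).
Proof. by rewrite hermitian_subproof expr0 mul1r. Qed.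

Lemma dot_eq0_sym x y : dot x y = 0 -> dot y x = 0.
Proof. by move=> xy0; rewrite dot_conj xy0 scalar_conj0. Qed.

Lemma dot_self_eq0 x : dot x x = 0 -> x = 0.
Proof. by rewrite -norm_dot => /eqP; rewrite sqrf_eq0 normr_eq0 => /eqP. Qed.

Lemma pythagoras x y : dot x y = 0 -> `|x + y| ^+ 2 = `|x| ^+ 2 + `|y| ^+ 2.
Proof.
move=> xy0; rewrite !norm_dot dotDl !dotDr xy0 (dot_eq0_sym xy0).
by rewrite addr0 add0r.
Qed.

Lemma parallelogram x y :
  `|x + y| ^+ 2 + `|x - y| ^+ 2 = (`|x| ^+ 2 + `|y| ^+ 2) *+ 2.
Proof.
rewrite !norm_dot dotBl !dotBr dotDl !dotDr.
ring.
Qed.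

(** Subtracting from x its component along f lowers the squared norm by
    |<x, f>|^2 / |f|^2, which a minimal norm does not permit unless
    <x, f> = 0. *)
Lemma dot_min_residual x f (d : K) : (forall c, d <= `|x - c *: f| ^+ 2) ->
  `|x| ^+ 2 <= d -> dot x f = 0.
Proof.
move=> dmin xd; have [->|f0] := eqVneq f 0; first exact: linear0r.
have ff0 : 0 < dot f f by rewrite -norm_dot exprn_gt0// normr_gt0.
set a := dot x f; apply: mul_conj_eq0; apply/eqP.
rewrite eq_le mul_conj_ge0 andbT.
have := le_trans xd (dmin (a / dot f f)).
rewrite !norm_dot dotBl !dotBr.
rewrite !(dotZl, dotZr) -/a [dot f x]dot_conj -/a.
rewrite scalar_conj_div -dot_conj.
rewrite divfK ?gt_eqF// subrr subr0 lerDl oppr_ge0 mulrAC [_ * a]mulrC.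
by rewrite pmulr_lle0 ?invr_gt0.
Qed.

Lemma orthocomp_submod F : submod_closed [in F^_|_].
Proof.
apply/submod_closedE; split=> [y _|a x y Fx Fy z Fz]; first exact: linear0l.
by rewrite dotDl dotZl Fx// Fy// mulr0 addr0.
Qed.

Lemma orthocomp_inter0 F x : F x -> F^_|_ x -> x = 0.
Proof. by move=> Fx /(_ _ Fx); exact: dot_self_eq0. Qed.

(** The algebraic form in which completeness is used: the space is the direct
    sum of F and its orthogonal complement. *)
Definition complemented F :=
  submod_closed [in F] /\ forall x, exists y, F y /\ F^_|_ (x - y).

Lemma orthocompK F : complemented F -> (F^_|_)^_|_ = F.
Proof.
move=> [/submod_closedE[F0 FD] Fdec]; apply/seteqP; split=> [x FFx|x Fx y Fy].
  have [y [Fy Fxy]] := Fdec x; suff xy0 : x - y = 0 by rewrite -(subrK y x) xy0 add0r.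
  apply: dot_self_eq0; rewrite dotBr (dot_eq0_sym (FFx _ Fxy)).
  by rewrite Fxy// subr0.
exact/dot_eq0_sym/Fy.
Qed.

Lemma complemented_orthocomp F : complemented F -> complemented F^_|_.
Proof.
move=> Fc; split; first exact: orthocomp_submod.
move=> x; have [y [Fy Fxy]] := Fc.2 x; exists (x - y); split=> //.
by rewrite orthocompK// subKr.
Qed.

Section Projector.
Variable F : set H.
Hypothesis Fc : complemented F.
Local Notation P := (orthoproj dot F).

Lemma orthoprojP x : F (P x) /\ F^_|_ (x - P x).
Proof. exact: (xgetPex 0 (Fc.2 x)). Qed.

Lemma orthoproj_mem x : F (P x). Proof. exact: (orthoprojP x).1. Qed.

Lemma orthoproj_eq x y : F y -> F^_|_ (x - y) -> P x = y.
Proof.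
move=> Fy Fxy; have [FP FxP] := orthoprojP x.
have [F0 FD] := (submod_closedE F).1 Fc.1.
have [_ F'D] := (submod_closedE _).1 (orthocomp_submod F).
apply/subr0_eq/(@orthocomp_inter0 F).
  by rewrite addrC -scaleN1r; exact: FD.
rewrite (_ : P x - y = -1 *: (x - P x) + (x - y)); first exact: F'D.
by rewrite scaleN1r opprB addrA subrK.
Qed.

Lemma orthoproj_id x : F x -> P x = x.
Proof.
move=> Fx; apply: orthoproj_eq => //; rewrite subrr => y _; exact: linear0l.
Qed.

(** In this form the function [orthoproj dot F] can be replaced by a bundled
    linear map, to which the general lemmas on linear maps apply. *)
Lemma orthoproj_linear : exists A : {linear H -> H}, P = A.
Proof.
have Plin : linear P.
  move=> a x y; have [Fx Fx'] := orthoprojP x; have [Fy Fy'] := orthoprojP y.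
  apply: orthoproj_eq; first exact: ((submod_closedE F).1 Fc.1).2.
  rewrite opprD addrACA -scalerBr.
  exact: ((submod_closedE _).1 (orthocomp_submod F)).2.
pose m := GRing.isLinear.Build K H H *:%R P Plin.
by exists (HB.pack_for {linear H -> H} P m).
Qed.

Lemma orthoproj_pythagoras x : `|x| ^+ 2 = `|P x| ^+ 2 + `|x - P x| ^+ 2.
Proof.
have [FP FxP] := orthoprojP x.
rewrite -pythagoras; last exact/dot_eq0_sym/FxP.
by rewrite addrC subrK.
Qed.

Lemma orthoproj_norm x : `|P x| <= `|x|.
Proof.
rewrite -(@ler_pXn2r _ 2)// ?nnegrE//.
by rewrite (orthoproj_pythagoras x) lerDl exprn_ge0.
Qed.

(** By Pythagoras the norm decreases strictly off F. *)
Lemma orthoproj_norm_eq x : `|x| <= `|P x| -> F x.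
Proof.
move=> xP; have {xP}: `|x| = `|P x|.
  by apply/eqP; rewrite eq_le xP orthoproj_norm.
move=> xP; have /eqP := orthoproj_pythagoras x.
rewrite xP -subr_eq0 opprD addrA subrr sub0r oppr_eq0 sqrf_eq0 normr_eq0.
by rewrite subr_eq0 => /eqP ->; exact: orthoproj_mem.
Qed.

End Projector.

Lemma orthoproj_orthocomp F x : complemented F ->
  orthoproj dot F^_|_ x = x - orthoproj dot F x.
Proof.
move=> Fc; have [FP FxP] := orthoprojP Fc x.
apply: (orthoproj_eq (complemented_orthocomp Fc)) => //.
by rewrite subKr orthocompK.
Qed.

End InnerProduct.

(** * The projection theorem *)

Section ProjectionTheorem.
Variables (R : realType) (k : scalars).
Local Notation K := (scalar_field R k).
Variables (H : completeNormedModType K) (dot : {dot H for @scalar_conj R k}).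
Hypothesis norm_dot : inner_product_space_norm dot.

(** The sets of points of F whose squared distance to x is less than d + e,
    where d is the infimum of the squared distances, generate a filter.  By the
    parallelogram law two such points are at squared distance less than 4 e,
    since their midpoint is in F; so the filter is Cauchy, and its limit is in
    F because F is closed. *)
Lemma closed_nearest_point (F : set H) x : closed_subspace F ->
  exists y, F y /\ forall z, F z -> `|x - y| ^+ 2 <= `|x - z| ^+ 2.
Proof.
move=> [/submod_closedE[F0 FD] Fclosed].
have [|a [z _ <-]|d [d0 dmin dP]] :=
  @ge0_inf_adherent R k [set `|x - z| ^+ 2 | z in F].
- by exists (`|x - 0| ^+ 2), 0.
- exact: exprn_ge0.
have {}dmin z : F z -> d <= `|x - z| ^+ 2 by move=> Fz; apply: dmin; exists z.
have {}dP e : 0 < e -> exists2 z, F z & `|x - z| ^+ 2 < d + e.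
  by move=> /dP[_ [z Fz <-]]; exists z.
pose B (e : K) := [set z | F z /\ `|x - z| ^+ 2 < d + e].
pose U := filter_from [set e : K | 0 < e] B.
have UP : ProperFilter U.
  apply: filter_from_proper; last by move=> e /dP[z Fz ze]; exists z.
  apply: filter_from_filter; first by exists 1; rewrite /= ltr01.
  move=> e e' /= e0 e'0.
  have Ble r s : r <= s -> B r `<=` B s.
    by move=> rs z [Fz zr]; split=> //; rewrite (lt_le_trans zr)// lerD2l.
  have [ee'|e'e] := orP (real_leVge (gtr0_real e0) (gtr0_real e'0)).
    by exists e => // z Bz; split=> //; exact: (Ble e).
  by exists e' => // z Bz; split=> //; exact: (Ble e').
have Ucauchy : cauchy U.
  apply/cauchyP => eps eps0; pose e := (eps / 2) ^+ 2.
  (* Two points of B e are at distance less than eps, as 4 e = eps ^ 2. *)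
  have e0 : 0 < e by rewrite exprn_gt0// divr_gt0.
  have [z0 Fz0 z0e] := dP _ e0; exists z0, e => // z [Fz ze].
  rewrite -ball_normE/= -(@ltr_pXn2r _ 2)// ?nnegrE ?(ltW eps0)//.
  have := parallelogram norm_dot (x - z) (x - z0).
  have Fm : F (2^-1 *: z0 + 2^-1 *: z).
    by apply: (FD) => //; rewrite -[_ *: z]addr0; exact: FD.
  have -> : x - z + (x - z0) = 2 *: (x - (2^-1 *: z0 + 2^-1 *: z)).
    rewrite scalerBr scalerDr !scalerA divff ?pnatr_eq0// !scale1r.
    by rewrite scaler_nat mulr2n addrACA opprD [- z0 - _]addrC.
  have -> : x - z - (x - z0) = z0 - z by rewrite opprB addrC addrA subrK.
  rewrite normrZ exprMn normr_nat => E.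
  rewrite -(ltrD2l (2 ^+ 2 * `|x - (2^-1 *: z0 + 2^-1 *: z)| ^+ 2)) E.
  apply: (@lt_le_trans _ _ (2 ^+ 2 * d + eps ^+ 2)); last first.
    by rewrite lerD2r ler_wpM2l ?exprn_ge0// dmin.
  have -> : 2 ^+ 2 * d + eps ^+ 2 = ((d + e) + (d + e)) *+ 2.
    by rewrite /e; field.
  by rewrite ltrMn2r//= ltrD.
have /(cauchy_cvg U) Ucvg := Ucauchy.
pose y := lim U.
have Fy : F y.
  apply: (@closed_cvg _ _ U UP id F Fclosed _ y Ucvg).
  by exists 1 => [|z [Fz _]]; rewrite /= ?ltr01.
exists y; split=> // z Fz; rewrite (le_trans _ (dmin _ Fz))// {z Fz}.
have xyr : `|x - y| ^+ 2 \is Num.real by rewrite realX// normr_real.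
rewrite real_leNgt//; last exact: ger0_real.
apply/negP => dxy.
set D := `|x - y| in xyr dxy.
have D0 : 0 <= D := normr_ge0 _.
pose h := D ^+ 2 - d; have h0 : 0 < h by rewrite subr_gt0.
(* A point z of F with |y - z| < e and |x - z|^2 < d + e^2 gives
   D^2 < d + e (4 e + 2 D); the choice of q makes e <= 1 and the right-hand
   side at most d + h = D^2, a contradiction. *)
pose q := 4 + 2 * D + h.
have q0 : 0 < q by rewrite addr_gt0// ltr_wpDr// mulr_ge0.
pose e := h / q.
have e0 : 0 < e by rewrite divr_gt0.
have e1 : e <= 1.
  by rewrite ler_pdivrMr// mul1r lerDr addr_ge0// mulr_ge0.
have : U (ball y e `&` B (e ^+ 2)).
  apply: filterI; last by exists (e ^+ 2) => //=; rewrite exprn_gt0.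
  exact/Ucvg/nbhsx_ballx.
move=> /filter_ex[z [yz [Fz xz]]]; move: yz; rewrite -ball_normE/= => yz.
have Dr : D <= `|x - z| + e.
  rewrite (le_trans (ler_distD z _ _))// lerD2l distrC; exact: ltW.
have rD : `|x - z| <= D + e.
  by rewrite (le_trans (ler_distD y _ _))// lerD2l; exact: ltW.
suff : D ^+ 2 < D ^+ 2 by rewrite ltxx.
apply: (@le_lt_trans _ _ ((`|x - z| + e) ^+ 2)).
  by rewrite ler_pXn2r ?nnegrE ?addr_ge0// ltW.
rewrite sqrrD; apply: (@lt_le_trans _ _ (d + e ^+ 2 + (D + e) * e *+ 2 + e ^+ 2)).
  by rewrite ltrD2r ltr_leD// lerMn2r/= ler_wpM2r// ltW.
rewrite (_ : _ + _ = d + e * (4 * e + 2 * D)); last by ring.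
rewrite -(subrK d (D ^+ 2)) -/h addrC lerD2r.
have -> : h = e * q by rewrite /e divfK// gt_eqF.
rewrite ler_wpM2l// ?(ltW e0)// -[leLHS]addr0 lerD ?(ltW h0)// lerD2r.
by rewrite ler_piMr.
Qed.

Lemma closed_complemented (F : set H) : closed_subspace F -> complemented dot F.
Proof.
move=> sF; have [F0 FD] := (submod_closedE F).1 sF.1; split; first exact: sF.1.
move=> x; have [y [Fy ymin]] := closed_nearest_point x sF.
exists y; split=> // f Ff; apply: (dot_min_residual norm_dot) (lexx _) => c.
by rewrite -addrA -opprD; apply: ymin; rewrite addrC; exact: FD.
Qed.

End ProjectionTheorem.

(** * Cosines of angles in the first quadrant *)

Section Acos.
Variable R : realType.
Implicit Types (sigma theta : R).

(** [acos] has the default value 0 here, so a number sigma > 1 can produce no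
    angle other than 0. *)
Lemma acos_gt1 sigma : 1 < sigma -> acos sigma = 0.
Proof.
move=> s1; rewrite unlock; case: xgetP => // y _ [_ ys].
by move: s1; rewrite -ys ltNge cos_le1.
Qed.

Lemma acos_ge0_itv sigma : 0 <= sigma -> 0 <= acos sigma <= pi / 2.
Proof.
move=> s0; have [s1|/acos_gt1->] := leP sigma 1; last by rewrite lexx divr_ge0 ?pi_ge0.
have sI : -1 <= sigma <= 1 by rewrite s1 (le_trans _ s0)// lerN10.
rewrite acos_ge0//= leNgt; apply/negP => p2.
have := acos_lepi sI; have [_ cE] := acos_def sI => p.
have : cos (acos sigma) < 0.
  rewrite -[acos sigma](subrK pi) cosDpi oppr_lt0 cos_gt0_pihalf//.
  rewrite ltrBrDr addrC [X in X - _]splitr addrK p2/= (le_lt_trans (_ : _ <= 0))//.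
    by rewrite subr_le0.
  by rewrite divr_gt0 ?pi_gt0.
by rewrite cE ltNge s0.
Qed.

Lemma cosK_pihalf theta : 0 <= theta <= pi / 2 -> acos (cos theta) = theta.
Proof.
move=> /andP[t0 t2]; apply: cosK; rewrite in_itv/= t0 (le_trans t2)//.
by rewrite ler_pdivrMr// ler_peMr ?pi_ge0// ler1n.
Qed.

Lemma cos_ge0_pihalf theta : 0 <= theta <= pi / 2 -> 0 <= cos theta.
Proof.
move=> /andP[t0]; rewrite le_eqVlt => /orP[/eqP ->|t2]; first by rewrite cos_pihalf.
by rewrite ltW// cos_gt0_pihalf// t2 andbT (lt_le_trans _ t0)// oppr_lt0 divr_gt0 ?pi_gt0.
Qed.

Lemma cos_sqr_pihalfB theta : cos (pi / 2 - theta) ^+ 2 = 1 - cos theta ^+ 2.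
Proof. by rewrite -[RHS]sin2cos2 addrC cosDpihalf sinN opprK. Qed.

Lemma cos_sqr_neq1 theta : 0 < theta <= pi / 2 -> cos theta ^+ 2 != 1.
Proof.
move=> /andP[t0 t2]; rewrite -subr_eq0 -opprB oppr_eq0 -sin2cos2 sqrf_eq0 gt_eqF//.
by rewrite sin_gt0_pi// t0 (le_lt_trans t2)// ltr_pdivrMr// ltr_pMr ?pi_gt0// ltr1n.
Qed.

Lemma cos_sqr_neq0 theta : 0 <= theta < pi / 2 -> cos theta ^+ 2 != 0.
Proof.
move=> /andP[t0 t2]; rewrite sqrf_eq0 gt_eqF// cos_gt0_pihalf// t2 andbT.
by rewrite (lt_le_trans _ t0)// oppr_lt0 divr_gt0 ?pi_gt0.
Qed.

End Acos.

(** * Angles and their multiplicities *)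

Section Angles.
Variables (R : realType) (k : scalars).
Local Notation K := (scalar_field R k).
Variables (H : normedModType K) (dot : {dot H for @scalar_conj R k}).
Hypothesis norm_dot : inner_product_space_norm dot.
Implicit Types (F G : set H) (x y : H) (lambda : K) (theta : R).
Local Notation "F ^_|_" := (orthocomp dot F).
Local Notation complemented := (complemented dot).
Local Notation projproj F G := (orthoproj dot F \o orthoproj dot G).
Local Notation cos2 theta := (of_real k (cos theta ^+ 2)).

Lemma complemented0 F : complemented F -> F 0.
Proof. by move=> [/submod_closedE[]]. Qed.

Lemma projproj_orthocomp F G x : complemented F -> complemented G -> F x ->
  projproj F G^_|_ x = x - projproj F G x.
Proof.
move=> Fc Gc Fx; rewrite /= (orthoproj_orthocomp norm_dot _ Gc).
have FxE := orthoproj_id norm_dot Fc Fx; have [A AE] := orthoproj_linear norm_dot Fc.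
by rewrite {1}AE linearB -AE FxE.
Qed.

Lemma spectrum_orthocompr F G lambda : complemented F -> complemented G ->
  spectrum F (projproj F G) lambda <->
  spectrum F (projproj F G^_|_) (1 - lambda).
Proof.
move=> Fc Gc; apply: spectrum_one_minus; first exact: Fc.1.
by move=> x Fx; exact: projproj_orthocomp.
Qed.

Lemma spectrum_projprojC F G lambda : complemented F -> complemented G ->
  lambda != 0 ->
  spectrum F (projproj F G) lambda <-> spectrum G (projproj G F) lambda.
Proof.
suff half F' G' : complemented F' -> complemented G' -> lambda != 0 ->
    spectrum F' (projproj F' G') lambda -> spectrum G' (projproj G' F') lambda.
  by move=> Fc Gc l0; split; exact: half.
move=> Fc Gc l0; apply: contra_not.
have [A AE] := orthoproj_linear norm_dot Fc.
have [B BE] := orthoproj_linear norm_dot Gc.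
rewrite AE BE; apply: (bounded_inverse_swap (a := 1) (b := 1)) => //.
- exact: Gc.1.
- exact: Fc.1.
- by move=> x _; rewrite -AE; exact: orthoproj_mem.
- by move=> x _; rewrite -BE; exact: orthoproj_mem.
- by move=> x; rewrite mul1r -AE; exact: orthoproj_norm.
- by move=> x; rewrite mul1r -BE; exact: orthoproj_norm.
Qed.

(** At lambda = 1 the exchange of G^perp and F would take place at the value 0,
    where the spectra of A B and B A may differ. *)
Lemma spectrum_orthocomp F G lambda : complemented F -> complemented G ->
  lambda != 1 ->
  spectrum F (projproj F G) lambda <->
  spectrum G^_|_ (projproj G^_|_ F^_|_) lambda.
Proof.
move=> Fc Gc l1; have G'c := complemented_orthocomp norm_dot Gc.
rewrite (spectrum_orthocompr _ Fc Gc) spectrum_projprojC//; last first.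
  by rewrite subr_eq0 eq_sym.
by rewrite (spectrum_orthocompr _ G'c Fc) subKr.
Qed.

Lemma eigenspace_orthocompr F G lambda : complemented F -> complemented G ->
  eigenspace_on F (projproj F G) lambda =
  eigenspace_on F (projproj F G^_|_) (1 - lambda).
Proof.
move=> Fc Gc; apply/seteqP; split=> x [Fx E]; split=> //.
  by rewrite projproj_orthocomp// E scalerBl scale1r.
by rewrite -[LHS](subKr x) -projproj_orthocomp// E scalerBl scale1r subKr.
Qed.

(** If P_F P_G x = x, then |x| <= |P_G x|, and x is in G. *)
Lemma eigenspace1 F G : complemented F -> complemented G ->
  eigenspace_on F (projproj F G) 1 = F `&` G.
Proof.
move=> Fc Gc; apply/seteqP; split=> x [Fx].
  rewrite scale1r /= => E; split=> //; apply: (orthoproj_norm_eq norm_dot Gc).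
  by rewrite -[x in leLHS]E; exact: orthoproj_norm.
by move=> Gx; split=> //; rewrite /= !orthoproj_id// scale1r.
Qed.

Lemma eigenspace0 F G : complemented F -> complemented G ->
  eigenspace_on F (projproj F G) 0 = F `&` G^_|_.
Proof.
move=> Fc Gc; rewrite eigenspace_orthocompr// subr0 eigenspace1//.
exact: complemented_orthocomp.
Qed.

Lemma eigenspace_image F G lambda : complemented F -> complemented G ->
  lambda != 0 ->
  orthoproj dot G @` eigenspace_on F (projproj F G) lambda =
  eigenspace_on G (projproj G F) lambda.
Proof.
move=> Fc Gc l0; have [A AE] := orthoproj_linear norm_dot Fc.
have [B BE] := orthoproj_linear norm_dot Gc.
apply/seteqP; split=> [_ [x [Fx /= E] <-]|y [Gy /= E]].
  by split; [exact: orthoproj_mem|rewrite /= E BE linearZ].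
have GE : orthoproj dot G (lambda^-1 *: orthoproj dot F y) = y.
  by rewrite BE linearZ/= -BE E scalerA mulVf// scale1r.
exists (lambda^-1 *: orthoproj dot F y) => //; split.
  rewrite -[_ *: _]addr0; apply: ((submod_closedE _).1 Fc.1).2.
    exact: orthoproj_mem.
  exact: complemented0.
by rewrite /= GE scalerA mulfV// scale1r.
Qed.

Lemma orthoproj_eigenspace_inj F G lambda x : complemented F ->
  lambda != 0 -> eigenspace_on F (projproj F G) lambda x ->
  orthoproj dot G x = 0 -> x = 0.
Proof.
move=> Fc l0 [Fx /= E] Gx0; move: E; rewrite Gx0 orthoproj_id//; last exact: complemented0.
by move=> /esym/eqP; rewrite scaler_eq0 (negPf l0) => /eqP.
Qed.

Lemma dimension_eigenspaceC F G lambda : complemented F -> complemented G ->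
  lambda != 0 ->
  dimension R (eigenspace_on F (projproj F G) lambda) =
  dimension R (eigenspace_on G (projproj G F) lambda).
Proof.
move=> Fc Gc l0; have [A AE] := orthoproj_linear norm_dot Fc.
have [B BE] := orthoproj_linear norm_dot Gc.
by apply: (@dimension_eq_image _ _ _ _ _ B A); rewrite -?AE -?BE;
  [exact: eigenspace_image|move=> x; exact: orthoproj_eigenspace_inj..
  |exact: eigenspace_image|move=> x; exact: orthoproj_eigenspace_inj].
Qed.

Lemma angles_from_itv F G theta : angles_from dot F G theta ->
  0 <= theta <= pi / 2.
Proof. by move=> [sigma [-> s0 _]]; exact: acos_ge0_itv. Qed.

(** The angle 0 is excluded because [acos] also sends every number greater
    than 1 to it. *)
Lemma angles_fromE F G theta : 0 < theta <= pi / 2 ->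
  angles_from dot F G theta <-> spectrum F (projproj F G) (cos2 theta).
Proof.
move=> /andP[t0 t2]; have t02 : 0 <= theta <= pi / 2 by rewrite ltW.
split=> [[sigma [tE s0]]|st]; last first.
  by exists (cos theta); rewrite cosK_pihalf// cos_ge0_pihalf.
have [s1|/acos_gt1 s1] := leP sigma 1; last by move: t0; rewrite tE s1 ltxx.
by rewrite tE acosK// in_itv/= s1 (le_trans _ s0)// lerN10.
Qed.

Lemma point_angles_fromE F G theta : F 0 -> 0 <= theta <= pi / 2 ->
  point_angles_from dot F G theta <->
  point_spectrum F (projproj F G) (cos2 theta).
Proof.
move=> F0 t02; split=> [[]//|pt]; split=> //.
exists (cos theta); rewrite cosK_pihalf// cos_ge0_pihalf//; split=> //.
exact: point_spectrum_spectrum pt.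
Qed.

Lemma anglesC F G : angles dot F G = angles dot G F.
Proof. exact: setIC. Qed.

Lemma angles_orthocomp F G theta : complemented F -> complemented G ->
  0 < theta -> angles dot F G theta <-> angles dot F^_|_ G^_|_ theta.
Proof.
move=> Fc Gc t0; have [t2|t2] := leP theta (pi / 2); last first.
  by split=> -[/angles_from_itv/andP[_]]; rewrite leNgt t2.
have l1 : cos2 theta != 1.
  by rewrite -of_real1 (inj_eq (@of_real_inj R k)) cos_sqr_neq1// t0.
rewrite [angles _ F^_|_ _]anglesC /angles /setI/= !angles_fromE ?t0//.
by rewrite -!spectrum_orthocomp.
Qed.

Lemma angles_orthocompr F G theta : complemented F -> complemented G ->
  0 < theta < pi / 2 ->
  angles dot F G theta <-> angles dot F G^_|_ (pi / 2 - theta).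
Proof.
move=> Fc Gc /andP[t0 t2]; have G'c := complemented_orthocomp norm_dot Gc.
have l0 : cos2 theta != 0.
  by rewrite -(@of_real0 R k) (inj_eq (@of_real_inj R k)) cos_sqr_neq0// ltW.
have l1 : 1 - cos2 theta != 0.
  by rewrite subr_eq0 eq_sym -of_real1 (inj_eq (@of_real_inj R k)) cos_sqr_neq1// t0 ltW.
rewrite /angles /setI/= !angles_fromE ?t0 ?(ltW t2) ?subr_gt0 ?t2 ?gerBl ?(ltW t0)//.
rewrite cos_sqr_pihalfB of_realB of_real1.
rewrite -(spectrum_projprojC Fc Gc l0) -(spectrum_projprojC Fc G'c l1).
by rewrite -spectrum_orthocompr.
Qed.

Lemma mult_fromE F G theta : F 0 -> 0 <= theta <= pi / 2 ->
  projproj F G 0 = 0 ->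
  mult_from dot F G theta =
  dimension R (eigenspace_on F (projproj F G) (cos2 theta)).
Proof.
move=> F0 t02 T0; rewrite /mult_from; case: asboolP => // npt.
rewrite (_ : eigenspace_on _ _ _ = [set 0]) ?dimension0//.
apply/seteqP; split=> [x Ex|_ ->]; last by split=> //; rewrite T0 scaler0.
apply/eqP/negPn/negP => x0; apply: npt; apply/point_angles_fromE => //.
by exists x.
Qed.

(** When theta is not a point angle on one of the sides, the eigenspace on that
    side is 0 and so is the minimum; this agrees with the convention that
    the multiplicity is then 0. *)
Lemma mult_min_dimension F G theta : complemented F -> complemented G ->
  0 <= theta <= pi / 2 ->
  mult dot F G theta =
  Order.min (dimension R (eigenspace_on F (projproj F G) (cos2 theta)))
            (dimension R (eigenspace_on G (projproj G F) (cos2 theta))).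
Proof.
move=> Fc Gc t02; have F0 := complemented0 Fc; have G0 := complemented0 Gc.
rewrite -!mult_fromE//=; try by rewrite !orthoproj_id.
rewrite /mult; case: asboolP => // npt; apply/esym.
have mult_from_ge0 F' G' : (0 <= mult_from dot F' G' theta)%E.
  by rewrite /mult_from; case: asboolP => // _; exact: dimension_ge0.
have mult_from_eq0 F' G' : ~ point_angles_from dot F' G' theta ->
  mult_from dot F' G' theta = 0%E by rewrite /mult_from => /asboolF ->.
have [pF|/mult_from_eq0->] := pselect (point_angles_from dot F G theta).
  by rewrite [X in Order.min _ X]mult_from_eq0 ?min_r// => pG; exact: npt.
by rewrite min_l.
Qed.

Lemma multC F G theta : mult dot F G theta = mult dot G F theta.
Proof. by rewrite /mult /point_angles setIC minC. Qed.

Lemma mult_interior F G theta : complemented F -> complemented G ->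
  0 < theta < pi / 2 ->
  mult dot F G theta =
  dimension R (eigenspace_on F (projproj F G) (cos2 theta)).
Proof.
move=> Fc Gc /andP[t0 t2]; rewrite mult_min_dimension ?(ltW t0) ?(ltW t2)//.
rewrite [X in Order.min _ X]dimension_eigenspaceC ?minxx//.
by rewrite -(@of_real0 R k) (inj_eq (@of_real_inj R k)) cos_sqr_neq0// ltW.
Qed.

Lemma mult_orthocompr F G theta : complemented F -> complemented G ->
  0 < theta < pi / 2 ->
  mult dot F G theta = mult dot F G^_|_ (pi / 2 - theta).
Proof.
move=> Fc Gc t02; have /andP[t0 t2] := t02.
rewrite !mult_interior//; last 2 first.
- exact: complemented_orthocomp.
- by rewrite subr_gt0 t2 gtrBl.
by rewrite cos_sqr_pihalfB of_realB of_real1 -eigenspace_orthocompr.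
Qed.

End Angles.

(** * Angles between complements *)

Theorem theorem2p7 (R : realType) (k : scalars)
    (H : completeNormedModType (scalar_field R k))
    (dot : {dot H for @scalar_conj R k})
    (norm_dot : inner_product_space_norm dot)
    (F G : set H)
    (F_subspace : closed_subspace F) (G_subspace : closed_subspace G)
    (F_nontrivial : F <> [set 0]) (F_proper : F <> setT)
    (G_nontrivial : G <> [set 0]) (G_proper : G <> setT) :
  let F' := orthocomp dot F in
  let G' := orthocomp dot G in
  let M00 := F `&` G in
  let M01 := F `&` G' in
  let M10 := F' `&` G in
  let M11 := F' `&` G' in
  [/\ [/\ angles dot F G `\` ([set 0] `|` [set pi / 2]) =
            [set pi / 2 - theta | theta in angles dot F G'] `\`
              ([set 0] `|` [set pi / 2]),
          angles dot F G `\` [set 0] = angles dot F' G' `\` [set 0] &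
          angles dot F G' `\` [set 0] = angles dot F' G `\` [set 0]],
      [/\ mult dot F G 0 = dimension R M00,
          mult dot F G' 0 = dimension R M01,
          mult dot F' G 0 = dimension R M10 &
          mult dot F' G' 0 = dimension R M11],
      [/\ mult dot F G (pi / 2) = Order.min (dimension R M01) (dimension R M10),
          mult dot F G' (pi / 2) = Order.min (dimension R M00) (dimension R M11),
          mult dot F' G (pi / 2) = Order.min (dimension R M00) (dimension R M11) &
          mult dot F' G' (pi / 2) = Order.min (dimension R M01) (dimension R M10)] &
      forall theta : R, 0 < theta < pi / 2 ->
        [/\ mult dot F G theta = mult dot F' G' theta,
            mult dot F G theta = mult dot F G' (pi / 2 - theta) &
            mult dot F G theta = mult dot F' G (pi / 2 - theta)]].
Proof.
move=> F' G' M00 M01 M10 M11.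
have Fc := closed_complemented norm_dot F_subspace.
have Gc := closed_complemented norm_dot G_subspace.
have F'c : complemented dot F' := complemented_orthocomp norm_dot Fc.
have G'c : complemented dot G' := complemented_orthocomp norm_dot Gc.
have F'K : orthocomp dot F' = F := orthocompK norm_dot Fc.
have G'K : orthocomp dot G' = G := orthocompK norm_dot Gc.
have angles_gt0 A B theta : angles dot A B theta -> theta <> 0 -> 0 < theta.
  by move=> [/angles_from_itv/andP[t0 _] _] /eqP; rewrite lt_def t0 andbT.
have angles_compl A B : complemented dot A -> complemented dot B ->
    angles dot A B `\` [set 0] =
    angles dot (orthocomp dot A) (orthocomp dot B) `\` [set 0].
  move=> Ac Bc; apply/seteqP; split=> theta [At t0]; split=> //;
    have tp := angles_gt0 _ _ _ At t0.
    exact/(angles_orthocomp norm_dot Ac Bc tp).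
  exact/(angles_orthocomp norm_dot Ac Bc tp).
split.
- split; [|exact: angles_compl|by rewrite (angles_compl F G')// G'K].
  apply/seteqP; split=> [theta [At tn0]|_ [[theta At <-] tn0]]; split=> //.
    have t0 : theta <> 0 by move=> tE; apply: tn0; left.
    have tp : 0 < theta < pi / 2.
      rewrite (angles_gt0 _ _ _ At t0) lt_neqAle.
      have [/angles_from_itv/andP[_ ->] _] := At.
      by rewrite andbT; apply/eqP => tE; apply: tn0; right.
    exists (pi / 2 - theta); last by rewrite subKr.
    exact/(angles_orthocompr norm_dot Fc Gc tp).
  have t2 : theta <> pi / 2 by move=> tE; apply: tn0; left; rewrite /= tE subrr.
  have t0 : theta <> 0 by move=> tE; apply: tn0; right; rewrite /= tE subr0.
  have tp : 0 < theta < pi / 2.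
    rewrite (angles_gt0 _ _ _ At t0) lt_neqAle.
    have [/angles_from_itv/andP[_ ->] _] := At.
    by rewrite andbT; apply/eqP.
  by have /(angles_orthocompr norm_dot Fc G'c tp) := At; rewrite G'K.
- have mult0 A B : complemented dot A -> complemented dot B ->
      mult dot A B 0 = dimension R (A `&` B).
    move=> Ac Bc; rewrite mult_min_dimension// ?lexx ?divr_ge0 ?pi_ge0//.
    by rewrite cos0 expr1n of_real1 !eigenspace1// [B `&` A]setIC minxx.
  by split; exact: mult0.
- have mult_pihalf A B : complemented dot A -> complemented dot B ->
      mult dot A B (pi / 2) =
      Order.min (dimension R (A `&` orthocomp dot B))
                (dimension R (orthocomp dot A `&` B)).
    move=> Ac Bc; rewrite mult_min_dimension// ?lexx ?divr_ge0 ?pi_ge0//.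
    by rewrite cos_pihalf expr0n of_real0 !eigenspace0// [B `&` _]setIC.
  by split; rewrite mult_pihalf ?F'K ?G'K// minC.
- move=> theta t02.
  have t02' : 0 < pi / 2 - theta < pi / 2.
    by case/andP: t02 => t0 t2; rewrite subr_gt0 t2 gtrBl.
  split; last by rewrite multC (mult_orthocompr norm_dot Gc Fc t02) multC.
  - rewrite (mult_orthocompr norm_dot Fc Gc t02) multC.
    by rewrite (mult_orthocompr norm_dot G'c Fc t02') subKr multC.
  - exact: mult_orthocompr.
Qed.
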